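(* Let $\mathbf{G}=(G,|-|)$ be a group with a conjugation-invariant norm. In length grading $0$, iterated magnitude homology recovers the group homology of $G$: $$MH^0_\bullet(\mathbf{G})\cong H_\bullet(G).$$ In length gradings $\ell>0$ we have $MH_0^\ell(\mathbf{G})=0=MH_1^\ell(\mathbf{G})$, while $$MH_2^\ell(\mathbf{G})\cong\mathbb{Z}\cdot\{\text{conjugacy classes of indecomposable elements of norm }\ell\text{ in }G\},$$ the free abelian group on that set.
   Context: A norm on a group $G$ with identity $e$ is a function $|-|:G\to\mathbb{R}$ with $|e|=0$, $|g|>0$ for $g\ne e$, and $|gh|\le|g|+|h|$. It is conjugation invariant if $|ghg^{-1}|=|h|$ for all $g,h$. The norm is not assumed symmetric (i.e. $|g^{-1}|=|g|$ is not required). The associated metric is $d(g,h)=|h^{-1}g|$, a (possibly non-symmetric) bi-invariant metric. This makes $\mathbf{G}$ a one-object category enriched in the monoidal category of generalized metric spaces (categories enriched in $([0,\infty],+,0)$, where $[0,\infty]$ has an arrow $u\to v$ iff $u\ge v$) and short maps, with $\ell^1$ product: the single hom-object is $(G,d)$ and composition is multiplication. An element $g\in G$ is indecomposable if $g\ne e$ and $|g|<|h^{-1}g|+|h|$ for all $h\in G\setminus\{e,g\}$. $H_\bullet(G)$ is ordinary group homology with coefficients in $\mathbb{Z}$. Coefficients. $\mathbf{Ab}^{[0,\infty)}$ is the category of abelian groups graded by $\ell\in[0,\infty)$ (''length grading''), with convolution product $(A\circledast B)^\ell=\bigoplus_{r+s=\ell}A^r\otimes_{\mathbb{Z}}B^s$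 and unit $\mathbb{Z}$ in length grading $0$. $\Sigma^*:[0,\infty]\to\mathbf{Ab}^{[0,\infty)}$ is the strong symmetric monoidal functor with $\Sigma^*(\infty)=0$ and, for $t<\infty$, $\Sigma^\ell(t)=\mathbb{Z}$ if $\ell=t$, else $0$ (non-identity arrows are sent to $0$). Magnitude nerve. If $(\mathcal{V},\otimes,I)$ is symmetric monoidal with $I$ terminal, and $\Sigma:\mathcal{V}\to\mathbb{A}$ is a strong symmetric monoidal functor to a symmetric monoidal closed abelian category with unit $\mathbb{I}$, then for a $\mathcal{V}$-category $\mathbf{X}$, $MB^\Sigma(\mathbf{X})$ is the simplicial object of $\mathbb{A}$ with $MB^\Sigma_n(\mathbf{X})=\bigoplus_{x_0,\dots,x_n}\Sigma\mathbf{X}(x_0,x_1)\otimes\cdots\otimes\Sigma\mathbf{X}(x_{n-1},x_n)$ (and $MB^\Sigma_0(\mathbf{X})=\bigoplus_x\mathbb{I}$); inner faces are induced by composition, outer faces by the terminal maps $\mathbf{X}(x_0,x_1)\to I$, $\mathbf{X}(x_{n-1},x_n)\to I$, and degeneracies by inserting identities. $MB^\Sigma:\mathcal{V}\mathbf{Cat}\to[\Delta^{\mathrm{op}},\mathbb{A}]$ is itself strong symmetric monoidal (pointwise tensor product), and $\mathcal{V}\mathbf{Cat}$ also has terminal unit, so for a $\mathcal{V}\mathbf{Cat}$-category $\mathbf{X}$ one can form the double magnitude nerve $MB^{MB^\Sigma}(\mathbf{X})$, a bisimplicial object of $\mathbb{A}$. $MH^*_\bullet(\mathbf{G})$ is the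 iterated magnitude homology: the homology of the chain complex (alternating sums of faces) of the diagonal simplicial object of $MB^{MB^{\Sigma}}(\mathbf{G})$, with $\Sigma=\Sigma^*$; $MH_k^\ell(\mathbf{G})$ is its part in homological degree $k$ and length grading $\ell$. *)

(* Defs.v *)
From HB Require Import structures.
From mathcomp Require Import all_boot all_order all_algebra.
From mathcomp Require Import boolp classical_sets reals.
From mathcomp Require Import freeg.
From mathcomp Require Import ring_quotient.

Set Implicit Arguments.
Unset Strict Implicit.
Unset Printing Implicit Defensive.

Import Order.TTheory GRing.Theory Num.Theory.

Local Open Scope ring_scope.

(* [G] ranges over mathcomp's possibly infinite [groupType]s.  The norm is not
   assumed symmetric, nor is the metric deduced from it. *)
Record conj_inv_norm (R : realType) (G : groupType) (N : G -> R) : Prop := {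
  norm_one : N 1%g = 0;
  norm_gt0 : forall g, g <> 1%g -> 0 < N g;
  norm_mul : forall g h, N (g * h)%g <= N g + N h;
  norm_conj : forall g h, N (g * h * g^-1)%g = N h
}.

Definition norm_dist (R : realType) (G : groupType) (N : G -> R) (g h : G) : R :=
  N (h^-1 * g)%g.

Definition indecomposable (R : realType) (G : groupType) (N : G -> R) (g : G)
    : Prop :=
  g <> 1%g /\
  forall h, h <> 1%g -> h <> g -> N g < N (h^-1 * g)%g + N h.

Definition conj_class (G : groupType) (g : G) : set G :=
  [set k | exists h, k = (h * g * h^-1)%g]%classic.

Definition indec_class (R : realType) (G : groupType) (N : G -> R) (l : R)
    : choiceType :=
  {C : set G | `[< exists g, [/\ indecomposable N g, N g = l
                               & C = conj_class g] >]}.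

Definition ab_iso (A B : zmodType) : Prop :=
  exists f : {additive A -> B}, bijective f.

Section Homology.

Variables (C : nat -> zmodType) (d : forall n, {additive C n.+1 -> C n}).

Definition cycle_pred n : {pred C n} :=
  match n return {pred C n} with
  | 0 => fun=> true
  | m.+1 => fun x => d m x == 0
  end.

Fact cycle_closed n : zmod_closed (@cycle_pred n).
Proof.
case: n => [|n]; split => //= [|x y]; rewrite !unfold_in /=.
  by rewrite raddf0.
by move=> /eqP dx /eqP dy; rewrite raddfB dx dy subrr.
Qed.

HB.instance Definition _ n :=
  GRing.isZmodClosed.Build (C n) (@cycle_pred n) (cycle_closed n).

Record cycle n := Cycle { cycle_val : C n; _ : cycle_pred cycle_val }.

HB.instance Definition _ n := [isSub for @cycle_val n].
HB.instance Definition _ n := [Choice of cycle n by <:].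
HB.instance Definition _ n :=
  [SubChoice_isSubZmodule of cycle n by <:].

Definition boundary_pred n : {pred cycle n} :=
  fun z => `[< exists x, d n x = val z >].

Fact boundary_closed n : zmod_closed (@boundary_pred n).
Proof.
split=> [|x y]; rewrite !unfold_in.
  by apply/asboolP; exists 0; rewrite !raddf0.
move=> /asboolP[u du] /asboolP[v dv]; apply/asboolP.
by exists (u - v); rewrite raddfB du dv raddfB.
Qed.

HB.instance Definition _ n :=
  GRing.isZmodClosed.Build (cycle n) (@boundary_pred n) (boundary_closed n).

(* cycles modulo those cycles that are boundaries: this is Ker/Im as soon as
   [d n \o d n.+1 = 0]. *)
Definition homology n : zmodType :=
  {ideal_quot (@boundary_pred n)}.

End Homology.

Section AlternatingSum.

Variables (C : nat -> zmodType).
Variable face : forall n, 'I_n.+2 -> {additive C n.+1 -> C n}.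

Definition alt_sum n (x : C n.+1) : C n :=
  \sum_(i < n.+2) face i x *~ (-1) ^+ i.

Fact alt_sum_is_zmod_morphism n : zmod_morphism (@alt_sum n).
Proof.
move=> x y; rewrite /alt_sum -sumrB; apply: eq_bigr => i _.
by rewrite raddfB mulrzBl.
Qed.

HB.instance Definition _ n :=
  GRing.isZmodMorphism.Build (C n.+1) (C n) (@alt_sum n)
    (alt_sum_is_zmod_morphism (n:=n)).

Definition simplicial_homology n : zmodType :=
  homology (fun m => [the {additive C m.+1 -> C m} of @alt_sum m]) n.

End AlternatingSum.

(* The faces of a nerve-like object.  [omit i] forgets the i-th vertex;
   [bar_face mul i] drops the first entry if i = 0, the last one if i = p.+1,
   and multiplies the two consecutive entries number i.-1 and i otherwise. *)
Definition omit (T : Type) n (i : 'I_n.+2) (x : {ffun 'I_n.+2 -> T})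
    : {ffun 'I_n.+1 -> T} :=
  [ffun j => x (fintype.lift i j)].

Definition bar_face (T : Type) (mul : T -> T -> T) p (i : 'I_p.+2)
    (r : {ffun 'I_p.+1 -> T}) : {ffun 'I_p -> T} :=
  [ffun j : 'I_p => let a := r (widen_ord (leqnSn p) j) in
                    let b := r (fintype.lift ord0 j) in
                    if (j.+1 < i)%N then a
                    else if j.+1 == i then mul a b else b].

(* The additive map Z[S] -> Z[T] sending the generator s to the generator t when
   f s = Some t, and to 0 when f s = None. *)
Section GeneratorMap.

Variables (S T : choiceType) (f : S -> option T).

Definition gen_value (s : S) : {freeg T} :=
  if f s is Some t then << t >> else 0.

Definition gen_map : {freeg S} -> {freeg T} := fglift gen_value.

HB.instance Definition _ :=
  GRing.isZmodMorphism.Build {freeg S} {freeg T} gen_map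
    (lift_is_additive gen_value).

End GeneratorMap.

(* Ordinary integral group homology, as the homology of the (unnormalised) bar
   complex, i.e. of the nerve of G with integer coefficients. *)
Section GroupHomology.

Variable G : groupType.

Definition group_chain n : zmodType := {freeg {ffun 'I_n -> G}}.

Definition group_face n (i : 'I_n.+2)
    : {additive group_chain n.+1 -> group_chain n} :=
  gen_map (fun r => Some (bar_face (fun g h => (g * h)%g) i r)).

Definition group_homology : nat -> zmodType := simplicial_homology group_face.

End GroupHomology.

(* A set of generators with lengths stands for the free length-graded abelian
   group on it.  Every object of Ab^[0,oo) entering the magnitude nerves below is
   of this form: Sigma^*(t) is a single generator of length t, and the sums and
   the convolution products of such objects are given by sums of sets and by
   products of sets with added lengths, since Z[S] (x) Z[T] = Z[S * T]. *)
Record graded_set (R : realType) := GradedSet {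
  gen :> choiceType;
  len : gen -> R
}.

Definition tensor_pow (R : realType) (n : nat) (S : graded_set R)
    : graded_set R :=
  @GradedSet R {ffun 'I_n -> S} (fun r => \sum_(i < n) len (r i)).

Definition graded_piece (R : realType) (S : graded_set R) (l : R) : zmodType :=
  {freeg {s : S | len s == l}}.

(* All the maps f below are, for a conjugation-invariant norm, non-increasing on
   lengths: factor by factor they are given by arrows u >= v of [0,oo] (triangle
   inequality, terminal map, or composition being a short map).  Sigma^* being
   strong monoidal, the tensor product of the images of these arrows is the image
   of the arrow len s >= len (f s) between total lengths, which Sigma^l sends to
   the identity of Z if both lengths are l, and to 0 if they differ. *)
Definition Sigma_map (R : realType) (S T : graded_set R) (f : S -> T) (l : R)
    : {additive graded_piece S l -> graded_piece T l} :=
  gen_map (fun s : {s : S | len s == l} =>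
             insub (f (val s)) : option {t : T | len t == l}).

(* Generators in simplicial degree q of the magnitude nerve of the generalised
   metric space (X, d): (x_0, ..., x_q) spans
   Sigma d(x_0, x_1) (x) ... (x) Sigma d(x_{q-1}, x_q). *)
Definition magnitude_nerve (R : realType) (X : choiceType) (d : X -> X -> R)
    (q : nat) : graded_set R :=
  @GradedSet R {ffun 'I_q.+1 -> X}
    (fun x => \sum_(j < q)
       d (x (widen_ord (leqnSn q) j)) (x (fintype.lift ord0 j))).

Section IteratedMagnitude.

Variables (R : realType) (G : groupType) (N : G -> R) (l : R).

(* Bidegree (p, q) of MB^{MB^Sigma}(G): as [G] has one object, this is the p-th
   tensor power of the degree q part of the magnitude nerve of its only
   hom-object, the metric space (G, norm_dist N). *)
Definition double_nerve p q : graded_set R :=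
  tensor_pow p (magnitude_nerve (norm_dist N) q).

(* In the direction p, the composition (g, h) |-> g * h acts on magnitude nerves
   vertexwise, and the terminal maps G -> pt discard a simplex; as
   MB^Sigma(pt) is the unit Z in length grading 0, a discarded simplex must have
   length 0. *)
Definition outer_face p q (i : 'I_p.+2) :
    {additive graded_piece (double_nerve p.+1 q) l
           -> graded_piece (double_nerve p q) l} :=
  Sigma_map
    (bar_face (fun x y : {ffun 'I_q.+1 -> G} => [ffun j => (x j * y j)%g]) i
       : double_nerve p.+1 q -> double_nerve p q) l.

Definition inner_face p q (i : 'I_q.+2) :
    {additive graded_piece (double_nerve p q.+1) l
           -> graded_piece (double_nerve p q) l} :=
  Sigma_map
    ((fun r => [ffun k => omit i (r k)])
       : double_nerve p q.+1 -> double_nerve p q) l.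

Definition diagonal_chain n : zmodType := graded_piece (double_nerve n n) l.

Definition diagonal_face n (i : 'I_n.+2)
    : {additive diagonal_chain n.+1 -> diagonal_chain n} :=
  inner_face n i \o outer_face n.+1 i.

Definition iterated_MH : nat -> zmodType := simplicial_homology diagonal_face.

End IteratedMagnitude.

(* Main.v *)
From HB Require Import structures.
From mathcomp Require Import all_boot all_order all_algebra.
From mathcomp Require Import reals freeg.
From mathcomp Require Import boolp classical_sets ring_quotient generic_quotient.
From mathcomp Require Import lra.
Require Import Defs.

Set Implicit Arguments.
Unset Strict Implicit.
Unset Printing Implicit Defensive.

Import Order.TTheory GRing.Theory Num.Theory.

Local Open Scope ring_scope.

(** The diagonal complex in degree n has as generators the n x (n+1) matrices
    over G whose rows have total length l, the length of a row being the sum of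
    the distances between consecutive entries. Face number i multiplies rows i
    and i+1 entrywise (or drops an extreme row) and deletes column i; it is zero
    if the length drops.

    In length 0 all rows are constant, since d separates points, so a generator
    is just an n-tuple in G and the faces are those of the bar complex: the two
    chain complexes are isomorphic ([iterated_MH_length0]).

    Let l > 0. There is no generator in degree 0. In degree 1 every chain is a
    cycle, and the edge (a, b) is, up to sign, the boundary of [fill_map (a, b)],
    the matrix with rows (1, 1, 1) and (a, b, b); so degree 1 homology vanishes.

    In degree 2, Eilenberg and Zilber suggest to compare with bidegree (1, 1) of
    the double complex, whose generators are the edges (a, b) with d a b = l:
    one passes to it by the Alexander-Whitney map and comes back by the shuffle
    map. There, the boundaries identify edges that differ by a left or a right
    translation, so that only the conjugacy class of b^-1 a remains, and they
    kill the edges with a point strictly between their ends, which are those with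
    b^-1 a decomposable. Accordingly [class_map] is the Alexander-Whitney map
    followed by (a, b) |-> class of b^-1 a, and [shuffle_map] sends a class to
    the shuffle of one of its elements. That these maps are inverse to each other
    in homology follows from three facts:
    - [class_map] kills boundaries ([class_map_bd]);
    - [shuffle_map] takes values in cycles and [class_map] retracts it
      ([bd_shuffle], [class_map_shuffle]);
    - modulo boundaries, x = shuffle_map (class_map x) - fill_map (bd x) for every
      2-chain x ([mod_bd_homotopy]), so a cycle with trivial classes is a
      boundary.
    The last identity is checked on generators. It is an explicit chain homotopy
    in disguise: each step of [cell_homotopy] evaluates the boundary of one
    well-chosen 3-cell, with degenerate rows, in any abelian group in which
    boundaries vanish. *)

(** * Homology of chain complexes *)
Definition additive_of (A B : zmodType) (f : A -> B) (fB : zmod_morphism f) :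
    {additive A -> B} :=
  HB.pack_for {additive A -> B} f (GRing.isZmodMorphism.Build A B f fB).

Section HomologyCriteria.

Variables (C : nat -> zmodType) (d : forall n, {additive C n.+1 -> C n}).

Lemma homology_pi_eq n (x y : cycle d n) :
  \pi_(homology d n)%qT x = \pi_(homology d n)%qT y <->
  exists w, d n w = val x - val y.
Proof.
rewrite (_ : (\pi x = \pi y)%qT <-> (x - y) \in @boundary_pred C d n).
  rewrite unfold_in; split => [/asboolP[w dw]|[w dw]].
    by exists w; rewrite dw raddfB.
  by apply/asboolP; exists w; rewrite dw -raddfB.
by rewrite Quotient.idealrBE; split => /eqP.
Qed.

Lemma homology_eq0 n :
  (forall x : cycle d n, exists w, d n w = val x) ->
  forall h : homology d n, h = 0.
Proof.
move=> bd h; rewrite -[h]reprK -[0]reprK; apply/homology_pi_eq.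
have [w dw] := bd (repr h - repr (0 : homology d n)).
by exists w; rewrite dw raddfB.
Qed.

(** The first isomorphism theorem. The map is only required on cycles because
    a map such as the passage to homology classes has no reason to extend to all
    chains. *)
Lemma homology_iso n (A : zmodType) (phi : {additive cycle d n -> A}) :
  (forall a, exists z, phi z = a) ->
  (forall z, phi z = 0 <-> exists w, d n w = val z) ->
  ab_iso (homology d n) A.
Proof.
move=> phi_surj phi_ker.
pose f (h : homology d n) : A := phi (repr h).
have fpi z : f (\pi_(homology d n)%qT z) = phi z.
  apply/eqP; rewrite /f -subr_eq0 -raddfB; apply/eqP/phi_ker.
  have [w dw] := (homology_pi_eq (repr (\pi_(homology d n)%qT z)) z).1 (reprK _).
  by exists w; rewrite dw raddfB.
have f_add : zmod_morphism f.
  by move=> x y; rewrite -[x]reprK -[y]reprK -raddfB !fpi raddfB.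
exists (additive_of f_add).
exists (fun a => \pi_(homology d n)%qT (sval (cid (phi_surj a)))).
  move=> h; rewrite -[h]reprK /= fpi; apply/homology_pi_eq.
  case: cid => z /= E.
  have /phi_ker[w dw] : phi (z - repr h) = 0 by rewrite raddfB E subrr.
  by exists w; rewrite dw raddfB.
by move=> a; rewrite /= fpi; case: cid.
Qed.

End HomologyCriteria.

Lemma homology_chain_iso (C C' : nat -> zmodType)
    (d : forall n, {additive C n.+1 -> C n})
    (d' : forall n, {additive C' n.+1 -> C' n})
    (f : forall n, {additive C n -> C' n}) n :
  (forall m, bijective (f m)) ->
  (forall m x, f m (d m x) = d' m (f m.+1 x)) ->
  ab_iso (homology d n) (homology d' n).
Proof.
move=> f_bij fd; have f_inj m := bij_inj (f_bij m).
have fz (z : cycle d n) : cycle_pred d' (f n (val z)).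
  case: n z => [|m] z //; have /= /eqP dz := valP z.
  by rewrite /= -fd dz raddf0.
pose g z : cycle d' n := Cycle (fz z).
have g_add : zmod_morphism (fun z => \pi_(homology d' n)%qT (g z)).
  by move=> x y; rewrite -raddfB; apply: congr1; apply: val_inj; rewrite /= !raddfB.
apply: (@homology_iso _ _ _ _ (additive_of g_add)) => [a|z].
  have [k fK kK] := f_bij n.
  have kz : cycle_pred d (k (val (repr a))).
    case: (n) k kK {fK} a => [|m] k kK a //=; apply/eqP/f_inj.
    rewrite fd kK raddf0; exact/eqP/(valP (repr a)).
  exists (Cycle kz); rewrite /= -[RHS]reprK; apply: congr1.
  by apply: val_inj; rewrite /= kK.
have pi0 : \pi_(homology d' n)%qT 0 = 0 by exact: raddf0.
rewrite /= -pi0 homology_pi_eq /= subr0.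
split=> [[w dw]|[w dw]]; last by exists (f n.+1 w); rewrite -fd dw.
have [k _ kK] := f_bij n.+1.
by exists (k w); apply: f_inj; rewrite fd kK dw.
Qed.

Lemma ab_iso_sym (A B : zmodType) : ab_iso A B -> ab_iso B A.
Proof.
move=> [f [g fK gK]]; exists (additive_of (can2_zmod_morphism fK gK)).
by exists f.
Qed.

Lemma alt_sum2E (C : nat -> zmodType)
    (face : forall n, 'I_n.+2 -> {additive C n.+1 -> C n}) x :
  @alt_sum C face 1 x =
  face 1%N ord0 x - face 1%N (fintype.lift ord0 ord0) x
  + face 1%N (fintype.lift ord0 (fintype.lift ord0 ord0)) x.
Proof.
by rewrite /alt_sum !big_ord_recl big_ord0 /= addr0 addrA.
Qed.

Lemma alt_sum3E (C : nat -> zmodType)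
    (face : forall n, 'I_n.+2 -> {additive C n.+1 -> C n}) x :
  @alt_sum C face 2 x =
  face 2%N ord0 x - face 2%N (fintype.lift ord0 ord0) x
  + face 2%N (fintype.lift ord0 (fintype.lift ord0 ord0)) x
  - face 2%N (fintype.lift ord0 (fintype.lift ord0 (fintype.lift ord0 ord0))) x.
Proof.
by rewrite /alt_sum !big_ord_recl big_ord0 /= addr0 !addrA.
Qed.

(** * Free graded pieces and the diagonal faces *)
Section FreeGroups.

Variable S : choiceType.

Lemma freeg_additive_ext (A : zmodType) (f g : {additive {freeg S} -> A}) :
  (forall s, f << s >> = g << s >>) -> f =1 g.
Proof.
move=> fg D; rewrite -[D]freeg_sumE !raddf_sum; apply: eq_bigr => s _.
have -> : << coeff s D *g s >> = << s >> *~ coeff s D :> {freeg S}.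
  by rewrite freegU_mulz intz.
by rewrite !raddfMz fg.
Qed.

Lemma fglift_gen (M : lmodType int) (v : S -> M) s :
  fglift v (<< s >> : {freeg S}) = v s.
Proof. by rewrite liftU scale1r. Qed.

Lemma gen_mapE (T : choiceType) (f : S -> option T) s :
  gen_map f << s >> = gen_value f s.
Proof. exact: fglift_gen. Qed.

End FreeGroups.

Section GradedPieces.

Variables (R : realType) (l : R).
Implicit Types S T : graded_set R.

(** Setting this to 0 in the wrong length absorbs the clause of each face map that
    a generator is sent to 0 unless its length is preserved: formulas for faces
    then need no case distinction. *)
Definition gen_at S (s : S) : graded_piece S l :=
  gen_value (fun t : S => insub t : option {t : S | len t == l}) s.

Lemma gen_at_len S (s : S) (sl : len s == l) : gen_at s = << Sub s sl >>.
Proof. by rewrite /gen_at /gen_value insubT. Qed.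

Lemma gen_at0 S (s : S) : len s <> l -> gen_at s = 0.
Proof. by move=> /eqP sl; rewrite /gen_at /gen_value insubN. Qed.

Lemma graded_piece_ext S (A : zmodType) (f g : {additive graded_piece S l -> A}) :
  (forall s, len s = l -> f (gen_at s) = g (gen_at s)) -> f =1 g.
Proof.
move=> fg; apply: freeg_additive_ext => s.
have := fg (val s) (eqP (valP s)); rewrite (gen_at_len (valP s)).
by rewrite (_ : Sub _ _ = s) //; apply: val_inj.
Qed.

Lemma Sigma_map_gen S T (f : S -> T) (s : S) :
  len s = l -> Sigma_map f l (gen_at s) = gen_at (f s).
Proof. by move=> /eqP sl; rewrite (gen_at_len sl); exact: gen_mapE. Qed.

End GradedPieces.

Section DiagonalFaces.

Variables (R : realType) (G : groupType) (N : G -> R) (l : R).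

Definition outer_gen p q (i : 'I_p.+2) (s : double_nerve N p.+1 q) :
    double_nerve N p q :=
  bar_face (fun x y : {ffun 'I_q.+1 -> G} => [ffun j => (x j * y j)%g]) i s.

Definition inner_gen p q (i : 'I_q.+2) (s : double_nerve N p q.+1) :
    double_nerve N p q :=
  [ffun k => omit i (s k)].

Lemma diagonal_face_gen n (i : 'I_n.+2) (s : double_nerve N n.+1 n.+1) :
  len s = l -> len (outer_gen i s) = l ->
  diagonal_face N l i (gen_at l s) = gen_at l (inner_gen i (outer_gen i s)).
Proof.
move=> sl tl; rewrite -(Sigma_map_gen _ tl) -[RHS]/(inner_face _ _ _ _ _).
by congr (inner_face _ _ _ _ _); rewrite -(Sigma_map_gen _ sl).
Qed.

Lemma diagonal_face_gen0 n (i : 'I_n.+2) (s : double_nerve N n.+1 n.+1) :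
  len s = l -> len (outer_gen i s) <> l -> diagonal_face N l i (gen_at l s) = 0.
Proof.
move=> sl tl; rewrite -[LHS]/(inner_face _ _ _ _ (outer_face _ _ _ _ _)).
by rewrite /outer_face Sigma_map_gen // gen_at0 // raddf0.
Qed.

End DiagonalFaces.

(** * Length grading 0 *)
Section LengthZero.

Variables (R : realType) (G : groupType) (N : G -> R).
Hypothesis HN : conj_inv_norm N.

Lemma dist_ge0 (a b : G) : 0 <= norm_dist N a b.
Proof.
rewrite /norm_dist; have [->|/eqP/(norm_gt0 HN)/ltW//] := eqVneq (b^-1 * a)%g 1%g.
by rewrite (norm_one HN).
Qed.

Lemma dist_self (a : G) : norm_dist N a a = 0.
Proof. by rewrite /norm_dist mulVg (norm_one HN). Qed.

Lemma dist_eq0 (a b : G) : norm_dist N a b = 0 -> a = b.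
Proof.
rewrite /norm_dist => ab0; apply/eqP; apply: contraT => /eqP ab.
suff /(norm_gt0 HN) : (b^-1 * a)%g <> 1%g by rewrite ab0 ltxx.
by move=> /(canRL (mulVKg b)); rewrite mulg1.
Qed.

Definition const_simplices n q (r : {ffun 'I_n -> G}) : double_nerve N n q :=
  [ffun k => [ffun => r k]].

Lemma const_simplices_len n q (r : {ffun 'I_n -> G}) :
  len (const_simplices q r) = 0.
Proof.
rewrite /= big1 // => k _; rewrite big1 // => j _.
by rewrite !ffunE dist_self.
Qed.

(** A vanishing sum of distances forces consecutive vertices to be at distance 0,
    hence equal because the norm is positive away from the identity. *)
Lemma len0_const_simplices n q (s : double_nerve N n q) :
  len s = 0 -> s = const_simplices q [ffun k => s k ord0].
Proof.
move=> /eqP; rewrite /= psumr_eq0; last first.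
  by move=> k _; apply: sumr_ge0 => j _; exact: dist_ge0.
move=> /allP s0; apply/ffunP => k; apply/ffunP => j; rewrite !ffunE.
have := s0 k (mem_index_enum k); rewrite psumr_eq0 /=; last first.
  by move=> i _; exact: dist_ge0.
move=> /allP sk0; case: j => j; elim: j => [|j IHj] lt_jq.
  by congr (s k _); apply: val_inj.
rewrite -(IHj (ltnW lt_jq)); apply/esym/dist_eq0.
have /eqP := sk0 (Ordinal (lt_jq : (j < q)%N)) (mem_index_enum _).
by congr (_ = _); congr norm_dist; congr (s k _); apply: val_inj.
Qed.

Lemma diagonal_face_const n (i : 'I_n.+2) (r : {ffun 'I_n.+1 -> G}) :
  diagonal_face N 0 i (gen_at 0 (const_simplices n.+1 r)) =
  gen_at 0 (const_simplices n (bar_face (fun g h => (g * h)%g) i r)).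
Proof.
have outer_const : outer_gen i (const_simplices n.+1 r) =
    const_simplices n.+1 (bar_face (fun g h => (g * h)%g) i r).
  apply/ffunP => k; apply/ffunP => j; rewrite !ffunE.
  by rewrite /=; do 2?case: ifP; rewrite !ffunE.
rewrite diagonal_face_gen ?outer_const ?const_simplices_len //.
by congr gen_at; apply/ffunP => k; apply/ffunP => j; rewrite !ffunE.
Qed.

Lemma iterated_MH_length0 k : ab_iso (iterated_MH N 0 k) (group_homology G k).
Proof.
apply: ab_iso_sym.
pose F n : {additive group_chain G n -> diagonal_chain N 0 n} :=
  gen_map (fun r => insub (const_simplices n r)).
have FE n r : F n << r >> = gen_at 0 (const_simplices n r) by exact: gen_mapE.
apply: (@homology_chain_iso _ _ _ _ F) => [m|m x].
  pose K : {additive diagonal_chain N 0 m -> group_chain G m} :=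
    gen_map (fun s : {s : double_nerve N m m | len s == 0} =>
               Some [ffun k => val s k ord0]).
  have KE s : len s = 0 -> K (gen_at 0 s) = << [ffun k => s k ord0] >>.
    by move=> /eqP s0; rewrite (gen_at_len s0) [LHS]gen_mapE.
  exists K.
    apply: (@freeg_additive_ext _ _ [the {additive _ -> _} of K \o F m] idfun) => r /=.
    rewrite FE KE ?const_simplices_len //; congr << _ >>.
    by apply/ffunP => j; rewrite !ffunE.
  apply: (@graded_piece_ext _ _ _ _ [the {additive _ -> _} of F m \o K] idfun) => s s0.
  by rewrite [LHS]/= KE // FE -len0_const_simplices.
have Fface (i : 'I_m.+2) : F m \o group_face G i =1 diagonal_face N 0 i \o F m.+1.
  apply: freeg_additive_ext => r.
  rewrite -[RHS]/(diagonal_face N 0 i (F m.+1 << r >>)) FE diagonal_face_const -FE.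
  by rewrite -[LHS]/(F m (gen_map _ << r >>)) gen_mapE.
rewrite -[LHS]/(F m (\sum_(i < m.+2) _)) (raddf_sum (F m)).
apply: eq_bigr => i _.
by rewrite (raddfMz (F m)) -[F m _]/((F m \o group_face G i) x) Fface.
Qed.

End LengthZero.
(** * The bi-invariant metric and indecomposable elements *)
Section NormDistance.

Variables (R : realType) (G : groupType) (N : G -> R).
Hypothesis HN : conj_inv_norm N.
Notation d := (norm_dist N).

Lemma dist_triangle a b c : d a c <= d a b + d b c.
Proof.
rewrite /norm_dist addrC; have := norm_mul HN (c^-1 * b)%g (b^-1 * a)%g.
by rewrite mulgA mulgK.
Qed.

Lemma dist_mull h a b : d (h * a)%g (h * b)%g = d a b.
Proof. by rewrite /norm_dist invgM -mulgA mulKg. Qed.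

Lemma dist_mulr h a b : d (a * h)%g (b * h)%g = d a b.
Proof.
rewrite /norm_dist -(norm_conj HN h^-1 (b^-1 * a)%g).
by rewrite invgM invgK !mulgA.
Qed.

Lemma dist_mul a a' b b' : d (a * b)%g (a' * b')%g <= d a a' + d b b'.
Proof.
have := dist_triangle (a * b)%g (a * b')%g (a' * b')%g.
by rewrite dist_mull dist_mulr addrC.
Qed.

Lemma dist_gt0 a b : a <> b -> 0 < d a b.
Proof.
move=> ab; rewrite lt0r (dist_ge0 HN) andbT.
by apply/eqP => /(dist_eq0 HN).
Qed.

Lemma indecomposable_conj h g :
  indecomposable N g -> indecomposable N (h * g * h^-1)%g.
Proof.
have conj_inj k k' : (h^-1 * k * h = k' -> k = h * k' * h^-1)%g.
  by move=> <-; rewrite -!mulgA mulgV mulg1 mulVKg.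
move=> [g1 g_indec]; split.
  move=> hg1; apply: g1; move/(canRL (mulgVK _)): hg1.
  by rewrite mul1g => /(canRL (mulKg _)); rewrite mulVg.
move=> k k1 kg; rewrite (norm_conj HN).
have /g_indec : (h^-1 * k * h)%g <> 1%g.
  by move=> /conj_inj; rewrite mulg1 mulgV.
move=> /(_ _)/wrap[]; first by move=> /conj_inj.
rewrite -[N k](norm_conj HN h^-1) invgK.
rewrite -[N (k^-1 * _)%g](norm_conj HN h^-1) invgK.
by rewrite !invgM invgK !mulgA mulgVK.
Qed.

(** By left invariance, a point m strictly between a and b gives the
    decomposition of b^-1 a through b^-1 m. *)
Lemma between_decomposable a m b :
  m <> a -> m <> b -> d a m + d m b = d a b -> ~ indecomposable N (b^-1 * a)%g.
Proof.
move=> ma mb amb [_ /(_ (b^-1 * m)%g)].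
case/(_ _)/wrap; first by move=> /(canRL (mulVKg _)); rewrite mulg1.
case/(_ _)/wrap; first by move=> /mulgI.
rewrite -/(d a b) -/(d m b) -/(d (b^-1 * a)%g (b^-1 * m)%g) dist_mull.
by rewrite amb ltxx.
Qed.

Lemma not_indecomposable g : g <> 1%g -> ~ indecomposable N g ->
  exists m, [/\ m <> 1%g, m <> g & d g m + d m 1%g = N g].
Proof.
move=> g1 g_dec; apply: contrapT => no_m; apply: g_dec; split=> // h h1 hg.
rewrite ltNge; apply/negP => le_h; apply: no_m; exists h; split=> //.
have := dist_triangle g h 1%g.
rewrite {1}/norm_dist invg1 mul1g => le_g; apply/eqP; rewrite eq_le le_g andbT.
by rewrite /norm_dist invg1 mul1g.
Qed.

Lemma conj_class_conj (h g : G) : conj_class (h * g * h^-1)%g = conj_class g.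
Proof.
apply/seteqP; split => k [x ->]; [exists (x * h)%g | exists (x * h^-1)%g].
  by rewrite invgM !mulgA.
by rewrite invgM invgK !mulgA !mulgVK.
Qed.

Lemma conj_class_eq (g k : G) : conj_class g = conj_class k ->
  exists h, g = (h * k * h^-1)%g.
Proof.
move=> gk; have : conj_class g g by exists 1%g; rewrite invg1 mulg1 mul1g.
by rewrite gk.
Qed.

Lemma indec_classP l g :
  (exists k, [/\ indecomposable N k, N k = l & conj_class g = conj_class k]) <->
  indecomposable N g /\ N g = l.
Proof.
split=> [[k [k_indec kl /conj_class_eq[h ->]]]|[g_indec gl]]; last by exists g.
by split; [exact: indecomposable_conj | rewrite (norm_conj HN)].
Qed.

End NormDistance.

(** * Boundaries of explicit cells *)
Section LowDegrees.

Variables (R : realType) (G : groupType) (N : G -> R) (l : R).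
Hypothesis HN : conj_inv_norm N.
Notation d := (norm_dist N).

(** The rows of the matrix [m] are the simplices of a generator of bidegree
    (p, q). *)
Definition simplices p q (m : seq (seq G)) : double_nerve N p q :=
  [ffun k : 'I_p => [ffun j : 'I_q.+1 => nth 1%g (nth [::] m k) j]].

Lemma len_simplices p q m : len (simplices p q m) =
  \sum_(k < p) \sum_(j < q)
    d (nth 1%g (nth [::] m k) j) (nth 1%g (nth [::] m k) j.+1).
Proof.
by apply: eq_bigr => k _; apply: eq_bigr => j _; rewrite !ffunE.
Qed.

Definition gen1 a b : diagonal_chain N l 1 :=
  gen_at l (simplices 1 1 [:: [:: a; b]]).

Definition gen2 x0 x1 x2 y0 y1 y2 : diagonal_chain N l 2 :=
  gen_at l (simplices 2 2 [:: [:: x0; x1; x2]; [:: y0; y1; y2]]).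

Definition gen3 x0 x1 x2 x3 y0 y1 y2 y3 z0 z1 z2 z3 : diagonal_chain N l 3 :=
  gen_at l (simplices 3 3 [:: [:: x0; x1; x2; x3]; [:: y0; y1; y2; y3];
                              [:: z0; z1; z2; z3]]).

Definition len2 x0 x1 x2 y0 y1 y2 := d x0 x1 + d x1 x2 + (d y0 y1 + d y1 y2).

Definition len3 x0 x1 x2 x3 y0 y1 y2 y3 z0 z1 z2 z3 :=
  d x0 x1 + d x1 x2 + d x2 x3 + (d y0 y1 + d y1 y2 + d y2 y3) +
  (d z0 z1 + d z1 z2 + d z2 z3).

Ltac len_tac :=
  rewrite len_simplices !big_ord_recl !big_ord0 /=
    ?big_ord_recl ?big_ord0 /= ?addr0 ?addrA.

Lemma len_simplices11 a b : len (simplices 1 1 [:: [:: a; b]]) = d a b.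
Proof. by len_tac. Qed.

Lemma len_simplices12 x0 x1 x2 :
  len (simplices 1 2 [:: [:: x0; x1; x2]]) = d x0 x1 + d x1 x2.
Proof. by len_tac. Qed.

Lemma len_simplices22 x0 x1 x2 y0 y1 y2 :
  len (simplices 2 2 [:: [:: x0; x1; x2]; [:: y0; y1; y2]]) = len2 x0 x1 x2 y0 y1 y2.
Proof. by rewrite /len2; len_tac. Qed.

Lemma len_simplices23 x0 x1 x2 x3 y0 y1 y2 y3 :
  len (simplices 2 3 [:: [:: x0; x1; x2; x3]; [:: y0; y1; y2; y3]]) =
  d x0 x1 + d x1 x2 + d x2 x3 + (d y0 y1 + d y1 y2 + d y2 y3).
Proof. by len_tac. Qed.

Lemma len_simplices33 x0 x1 x2 x3 y0 y1 y2 y3 z0 z1 z2 z3 :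
  len (simplices 3 3 [:: [:: x0; x1; x2; x3]; [:: y0; y1; y2; y3];
                         [:: z0; z1; z2; z3]]) =
  len3 x0 x1 x2 x3 y0 y1 y2 y3 z0 z1 z2 z3.
Proof. by rewrite /len3; len_tac. Qed.

Definition len_simplicesE := (len_simplices11, len_simplices12, len_simplices22,
  len_simplices23, len_simplices33).

Lemma gen1_len0 a b : d a b <> l -> gen1 a b = 0.
Proof. by move=> abl; apply: gen_at0; rewrite len_simplices11. Qed.

Lemma gen2_len0 x0 x1 x2 y0 y1 y2 :
  len2 x0 x1 x2 y0 y1 y2 <> l -> gen2 x0 x1 x2 y0 y1 y2 = 0.
Proof. by move=> xyl; apply: gen_at0; rewrite len_simplices22. Qed.

(** The second step of a face may only be applied to a generator of length l; if
    the first step already loses length then so does the composite, because no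
    step increases length. This is why the two inequalities suffice to get rid of
    all conditions on lengths. *)
Lemma face_simplices n (i : 'I_n.+2) m m' m'' :
  len (simplices n.+1 n.+1 m) = l ->
  outer_gen i (simplices n.+1 n.+1 m) = simplices n n.+1 m' ->
  inner_gen i (simplices n n.+1 m') = simplices n n m'' ->
  len (simplices n n m'') <= len (simplices n n.+1 m')
    <= len (simplices n.+1 n.+1 m) ->
  diagonal_face N l i (gen_at l (simplices n.+1 n.+1 m)) =
  gen_at l (simplices n n m'').
Proof.
move=> ml oE <- /andP[le1 le2].
have [ol|/eqP ol] := eqVneq (len (simplices n n.+1 m')) l.
  by rewrite diagonal_face_gen // oE.
rewrite diagonal_face_gen0 ?oE // gen_at0 // => il; apply: ol.
by apply/eqP; rewrite eq_le -{2}il -{1}ml le1 le2.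
Qed.

Ltac mat_tac :=
  apply/ffunP => -[[|[|[|k]]] lt_k] //; apply/ffunP => -[[|[|[|[|j]]]] lt_j] //;
  rewrite !ffunE /= ?ffunE //=.

Notation bd n := (@alt_sum _ (diagonal_face N l) n).

Ltac face_tac m m' ineq :=
  rewrite (@face_simplices _ _ _ m m');
    [|by rewrite ?len_simplicesE //|by mat_tac|by mat_tac|
    by rewrite !len_simplicesE ?/len2 ?/len3; ineq].

Lemma boundary2 x0 x1 x2 y0 y1 y2 :
  len2 x0 x1 x2 y0 y1 y2 = l ->
  bd 1 (gen2 x0 x1 x2 y0 y1 y2) =
  gen1 y1 y2 - gen1 (x0 * y0)%g (x2 * y2)%g + gen1 x0 x1.
Proof.
move=> xyl; rewrite alt_sum2E /gen2.
have := (dist_ge0 HN x0 x1, dist_ge0 HN x1 x2, dist_ge0 HN y0 y1, dist_ge0 HN y1 y2).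
move=> [[[dx01 dx12] dy01] dy12].
have tri := dist_triangle HN (x0 * y0)%g (x1 * y1)%g (x2 * y2)%g.
have m01 := dist_mul HN x0 x1 y0 y1.
have m12 := dist_mul HN x1 x2 y1 y2.
congr (_ - _ + _).
- face_tac [:: [:: y0; y1; y2]] [:: [:: y1; y2]] ltac:(lra). by [].
- face_tac [:: [:: x0 * y0; x1 * y1; x2 * y2]%g]
    [:: [:: x0 * y0; x2 * y2]%g] ltac:(lra). by [].
- face_tac [:: [:: x0; x1; x2]] [:: [:: x0; x1]] ltac:(lra). by [].
Qed.

Lemma boundary3 x0 x1 x2 x3 y0 y1 y2 y3 z0 z1 z2 z3 :
  len3 x0 x1 x2 x3 y0 y1 y2 y3 z0 z1 z2 z3 = l ->
  bd 2 (gen3 x0 x1 x2 x3 y0 y1 y2 y3 z0 z1 z2 z3) =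
  gen2 y1 y2 y3 z1 z2 z3
  - gen2 (x0 * y0)%g (x2 * y2)%g (x3 * y3)%g z0 z2 z3
  + gen2 x0 x1 x3 (y0 * z0)%g (y1 * z1)%g (y3 * z3)%g
  - gen2 x0 x1 x2 y0 y1 y2.
Proof.
move=> xyzl; rewrite alt_sum3E /gen3.
have := (dist_ge0 HN x0 x1, dist_ge0 HN x1 x2, dist_ge0 HN x2 x3).
move=> [[dx01 dx12] dx23].
have := (dist_ge0 HN y0 y1, dist_ge0 HN y1 y2, dist_ge0 HN y2 y3).
move=> [[dy01 dy12] dy23].
have := (dist_ge0 HN z0 z1, dist_ge0 HN z1 z2, dist_ge0 HN z2 z3).
move=> [[dz01 dz12] dz23].
have txy := dist_triangle HN (x0 * y0)%g (x1 * y1)%g (x2 * y2)%g.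
have tz := dist_triangle HN z0 z1 z2.
have tyz := dist_triangle HN (y1 * z1)%g (y2 * z2)%g (y3 * z3)%g.
have tx := dist_triangle HN x1 x2 x3.
have mxy01 := dist_mul HN x0 x1 y0 y1.
have mxy12 := dist_mul HN x1 x2 y1 y2.
have mxy23 := dist_mul HN x2 x3 y2 y3.
have myz01 := dist_mul HN y0 y1 z0 z1.
have myz12 := dist_mul HN y1 y2 z1 z2.
have myz23 := dist_mul HN y2 y3 z2 z3.
congr (_ - _ + _ - _).
- face_tac [:: [:: y0; y1; y2; y3]; [:: z0; z1; z2; z3]]
    [:: [:: y1; y2; y3]; [:: z1; z2; z3]] ltac:(lra). by [].
- face_tac [:: [:: x0 * y0; x1 * y1; x2 * y2; x3 * y3]%g; [:: z0; z1; z2; z3]]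
    [:: [:: x0 * y0; x2 * y2; x3 * y3]%g; [:: z0; z2; z3]] ltac:(lra). by [].
- face_tac [:: [:: x0; x1; x2; x3]; [:: y0 * z0; y1 * z1; y2 * z2; y3 * z3]%g]
    [:: [:: x0; x1; x3]; [:: y0 * z0; y1 * z1; y3 * z3]%g] ltac:(lra). by [].
- face_tac [:: [:: x0; x1; x2; x3]; [:: y0; y1; y2; y3]]
    [:: [:: x0; x1; x2]; [:: y0; y1; y2]] ltac:(lra). by [].
Qed.

End LowDegrees.
(** * Cells of degree 2 modulo boundaries *)
Section CellsModuloBoundaries.

Variables (R : realType) (G : groupType) (N : G -> R) (l : R).
Hypotheses (HN : conj_inv_norm N) (l_gt0 : 0 < l).
Notation d := (norm_dist N).
(* [cell] stands for the generators of degree 2 in any quotient of the group of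
   2-chains in which boundaries vanish. *)
Variables (A : zmodType) (cell : G -> G -> G -> G -> G -> G -> A).

Hypothesis cell_len : forall x0 x1 x2 y0 y1 y2,
  len2 N x0 x1 x2 y0 y1 y2 <> l -> cell x0 x1 x2 y0 y1 y2 = 0.
Hypothesis cell_boundary : forall x0 x1 x2 x3 y0 y1 y2 y3 z0 z1 z2 z3,
  len3 N x0 x1 x2 x3 y0 y1 y2 y3 z0 z1 z2 z3 = l ->
  cell y1 y2 y3 z1 z2 z3
  - cell (x0 * y0)%g (x2 * y2)%g (x3 * y3)%g z0 z2 z3
  + cell x0 x1 x3 (y0 * z0)%g (y1 * z1)%g (y3 * z3)%g
  - cell x0 x1 x2 y0 y1 y2 = 0.

Let d_self := dist_self HN.
Let d_ge0 := dist_ge0 HN.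

Ltac small := rewrite /len2 ?d_self ?add0r ?addr0; first [assumption | lra].

(** The boundary of this cell is minus the edge (a, b). *)
Definition fill a b : A := cell 1%g 1%g 1%g a b b.

Lemma fill_len a b : d a b <> l -> fill a b = 0.
Proof. by move=> abl; apply: cell_len; rewrite /len2 !d_self !add0r addr0. Qed.

Lemma fill_lt a b : d a b < l -> fill a b = 0.
Proof. by move=> abl; apply: fill_len => ab; rewrite ab ltxx in abl. Qed.

Lemma edge_neq a b : d a b = l -> a <> b.
Proof. by move=> abl ab; move: l_gt0; rewrite -abl ab d_self ltxx. Qed.

Lemma cell_lt x0 x1 x2 y0 y1 y2 :
  len2 N x0 x1 x2 y0 y1 y2 < l -> cell x0 x1 x2 y0 y1 y2 = 0.
Proof. by move=> ll; apply: cell_len => el; rewrite el ltxx in ll. Qed.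

(** Boundary of the 3-cell with rows 1, 1 and (a, b, c, c). *)
Lemma fill_path a b c : a <> b -> d a b + d b c = l ->
  cell 1%g 1%g 1%g a b c = fill a c.
Proof.
move=> ab abc; have ab0 := dist_gt0 HN ab.
have := @cell_boundary 1 1 1 1 1 1 1 1 a b c c;
  rewrite /len3 !mul1g !d_self.
move=> /(_ _)/wrap[]; first by rewrite -abc; lra.
rewrite (cell_lt (y0 := b)); last by small.
rewrite (cell_lt (y0 := 1%g)); last by small.
by rewrite sub0r subr0 addrC => /eqP; rewrite subr_eq0 => /eqP.
Qed.

(** Boundary of the 3-cell with rows 1, (x0, x1, x1, x2) and (y0, y1, y1, y2). If
    some row moves in its first step, this trades the cell for the one with rows 1
    and the product of the two rows, to which [fill_path] applies. *)
Lemma cell_first_step x0 x1 x2 y0 y1 y2 : x0 <> x1 \/ y0 <> y1 ->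
  len2 N x0 x1 x2 y0 y1 y2 = l ->
  cell x0 x1 x2 y0 y1 y2 = fill (x0 * y0)%g (x2 * y2)%g - fill x0 x1.
Proof.
move=> xy01; rewrite /len2 => xyl.
have d01 : 0 < d x0 x1 + d y0 y1.
  by case: xy01 => /(dist_gt0 HN) ?;
    [have := d_ge0 y0 y1 | have := d_ge0 x0 x1]; lra.
clear xy01; have := @cell_boundary 1 1 1 1 x0 x1 x1 x2 y0 y1 y1 y2;
  rewrite /len3 !mul1g !d_self.
move=> /(_ _)/wrap[]; first by rewrite -xyl; lra.
rewrite (cell_lt (x0 := x1)); last by small.
rewrite sub0r -/(fill x0 x1) => /eqP; rewrite subr_eq0 addrC subr_eq addrC => /eqP H.
apply/eqP; rewrite eq_sym subr_eq -H; apply/eqP; clear H.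
have := dist_triangle HN (x0 * y0)%g (x1 * y1)%g (x2 * y2)%g.
have := dist_mul HN x0 x1 y0 y1; have := dist_mul HN x1 x2 y1 y2 => m12 m01 tri.
have [ll|/eqP ll] :=
  eqVneq (d (x0 * y0)%g (x1 * y1)%g + d (x1 * y1)%g (x2 * y2)%g) l.
  rewrite fill_path // => xy; rewrite xy d_self in ll m01; clear xy; lra.
rewrite cell_len ?fill_lt //; last by rewrite /len2 !d_self !add0r.
have {}ll : d (x0 * y0)%g (x1 * y1)%g + d (x1 * y1)%g (x2 * y2)%g < l.
  by rewrite lt_neqAle; apply/andP; split; [exact/eqP | lra].
lra.
Qed.


(** Boundary of the 3-cell with rows a, 1 and (u, u, v, v): the remaining terms
    all have a non-constant first step. *)
Lemma cell_translate a u v : d u v = l ->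
  cell a a a u u v = fill (a * u)%g (a * v)%g - fill u v.
Proof.
move=> uvl; have uv := edge_neq uvl.
have := @cell_boundary a a a a 1 1 1 1 u u v v;
  rewrite /len3 !mul1g !mulg1 !d_self.
move=> /(_ _)/wrap[]; first by rewrite -uvl; lra.
rewrite (cell_lt (x0 := a) (y0 := 1%g)); last by small.
rewrite subr0 -/(fill u v) (@cell_first_step a a a u v v); first last.
- by rewrite /len2 !d_self; lra.
- by right.
rewrite (@fill_lt a a) ?d_self // subr0 addrC => /eqP.
by rewrite addr_eq0 opprB => /eqP.
Qed.

(** The shuffle of the bar generator g with the edge (g, 1), up to sign. *)
Definition edge_class g : A := cell g g 1%g 1%g 1%g 1%g - fill g 1%g.

(** Boundary of the 3-cell with rows (a, a, a, a'), b and c. *)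
Lemma cell_right_act a a' b c : d a a' = l ->
  cell a a a' (b * c)%g (b * c)%g (b * c)%g =
  cell (a * b)%g (a * b)%g (a' * b)%g c c c.
Proof.
move=> aal.
have := @cell_boundary a a a a' b b b b c c c c; rewrite /len3 !d_self.
move=> /(_ _)/wrap[]; first by rewrite -aal; lra.
rewrite (cell_lt (x0 := b)); last by small.
rewrite (cell_lt (x0 := a) (x1 := a) (x2 := a)); last by small.
by rewrite sub0r subr0 addrC => /eqP; rewrite subr_eq0 => /eqP.
Qed.

(** Boundary of the 3-cell with rows (a, a, a', a'), 1 and c. *)
Lemma cell_right_shift a a' c : d a a' = l ->
  cell a a a' c c c =
  cell a a a' 1%g 1%g 1%g + fill (a * c)%g (a' * c)%g - fill a a'.
Proof.
move=> aal; have neq := edge_neq aal.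
have := @cell_boundary a a a' a' 1 1 1 1 c c c c;
  rewrite /len3 !mulg1 !mul1g !d_self.
move=> /(_ _)/wrap[]; first by rewrite -aal; lra.
rewrite (cell_lt (x0 := 1%g)); last by small.
rewrite (@cell_first_step a a' a' c c c); first last.
- by rewrite /len2 !d_self; lra.
- by left.
rewrite sub0r opprB => /eqP; rewrite subr_eq0 => /eqP <-.
by rewrite [_ - _ + cell _ _ _ _ _ _]addrC -(addrA (cell _ _ _ _ _ _)) subrK addrK.
Qed.

(** Boundary of the 3-cell with rows a', (g, g, g, 1) and 1, where g = a'^-1 a:
    it moves the edge (g, 1) to (a, a') by the left translation by a'. *)
Lemma cell_edge_one a a' : d a a' = l ->
  cell a a a' 1%g 1%g 1%g = fill a a' + edge_class (a'^-1 * a)%g.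
Proof.
move=> aal; have neq := edge_neq aal.
set g := (a'^-1 * a)%g.
have gl : d g 1%g = l by rewrite /g -(mulVg a') (dist_mull N).
have := @cell_boundary a' a' a' a' g g g 1 1 1 1 1; rewrite /len3 !mulg1 !d_self.
move=> /(_ _)/wrap[]; first by rewrite -gl; lra.
rewrite (cell_translate a' gl) mulg1 mulVKg.
rewrite (cell_lt (x0 := a') (y0 := g)); last by small.
rewrite subr0 addrAC => /eqP; rewrite subr_eq0 => /eqP <-.
by rewrite /edge_class addrCA.
Qed.

Lemma cell_edge a a' b : d a a' = l ->
  cell a a a' b b b = fill (a * b)%g (a' * b)%g + edge_class (a'^-1 * a)%g.
Proof.
move=> aal; rewrite cell_right_shift // cell_edge_one //.
by rewrite addrAC [fill a a' + _]addrC addrK addrC.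
Qed.

(** The two ways of acting on the right on the edge (g, 1) by h^-1 agree by
    [cell_right_act], and their fillings are equal, so their edge classes agree. *)
Lemma edge_class_conj h g : N g = l ->
  edge_class (h * g * h^-1)%g = edge_class g.
Proof.
move=> gl; have gd : d g 1%g = l by rewrite /norm_dist invg1 mul1g.
have := cell_right_act h^-1 1 gd.
rewrite !cell_edge ?(dist_mulr HN) // !mulg1 invg1 !mul1g invgK mulgA.
by move=> /addrI.
Qed.

(** Boundary of the 3-cell with rows (a, a, m, a'), 1 and 1: a point between a and
    a' makes the first step of the cell non-constant. *)
Lemma cell_between a m a' : d a m + d m a' = d a a' -> d a a' = l ->
  a <> m -> m <> a' -> cell a a a' 1%g 1%g 1%g = fill a a'.
Proof.
move=> am_ma aal am ma; have am0 := dist_gt0 HN am; have ma0 := dist_gt0 HN ma.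
have := @cell_boundary a a m a' 1 1 1 1 1 1 1 1; rewrite /len3 !mulg1 !d_self.
move=> /(_ _)/wrap[]; first by rewrite -aal -am_ma; lra.
rewrite (cell_lt (x0 := 1%g)); last by small.
rewrite (cell_lt (x2 := m)); last by small.
rewrite (@cell_first_step a m a' 1 1 1) ?mulg1; first last.
- by rewrite /len2 !d_self; lra.
- by left.
rewrite (@fill_lt a m); last by lra.
by rewrite sub0r !subr0 addrC => /eqP; rewrite subr_eq0 => /eqP.
Qed.

Lemma edge_class_decomposable g : N g = l -> ~ indecomposable N g ->
  edge_class g = 0.
Proof.
move=> gl g_dec; have g1 : g <> 1%g.
  by move=> g1; move: l_gt0; rewrite -gl g1 (norm_one HN) ltxx.
have [m [m1 mg gm]] := not_indecomposable HN g1 g_dec.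
have gd : d g 1%g = N g by rewrite /norm_dist invg1 mul1g.
rewrite /edge_class (@cell_between g m 1) ?subrr ?gd //; exact/nesym.
Qed.

(** Boundary of the 3-cell with rows (a, a, a, a'), (b, b, b, b') and 1. If the
    product edge from a b to a' b' still has length l, then a b' lies strictly
    between its ends. *)
Lemma cell_two_edges a a' b b' : a <> a' -> b <> b' -> d a a' + d b b' = l ->
  cell a a a' b b b' = fill (a * b)%g (a' * b')%g.
Proof.
move=> aa bb ll; have aa0 := dist_gt0 HN aa; have bb0 := dist_gt0 HN bb.
have := @cell_boundary a a a a' b b b b' 1 1 1 1; rewrite /len3 !mulg1 !d_self.
move=> /(_ _)/wrap[]; first by rewrite -ll; lra.
rewrite (cell_lt (x0 := b)); last by small.
rewrite (cell_lt (x1 := a) (x2 := a)); last by small.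
rewrite sub0r !subr0 addrC => /eqP; rewrite subr_eq0 => /eqP ->.
have [el|nel] := eqVneq (d (a * b)%g (a' * b')%g) l; last first.
  rewrite cell_len ?fill_len //; first exact/eqP.
  by rewrite /len2 !d_self !add0r !addr0; exact/eqP.
apply: (@cell_between _ (a * b')%g) => //.
- by rewrite (dist_mull N) (dist_mulr HN) el addrC.
- by move=> /mulgI.
- by move=> /mulIg.
Qed.

(** The cells are sorted by the row and the step in which they move: the case of a
    non-constant first step is [cell_first_step]; otherwise the second step moves
    in the second row only ([cell_translate]), in the first row only
    ([cell_edge]) or in both ([cell_two_edges]). The last term is [fill] applied
    to the boundary of the cell. *)
Lemma cell_homotopy x0 x1 x2 y0 y1 y2 : len2 N x0 x1 x2 y0 y1 y2 = l ->
  cell x0 x1 x2 y0 y1 y2 =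
  (if [&& x0 == x1, y0 == y1, y1 == y2 & `[< indecomposable N (x2^-1 * x1)%g >]]
   then edge_class (x2^-1 * x1)%g else 0)
  - (fill y1 y2 - fill (x0 * y0)%g (x2 * y2)%g + fill x0 x1).
Proof.
have eqB (p q : A) : - (p - q + 0) = q - p by rewrite addr0 opprB.
move=> xyl; have ll := xyl; rewrite /len2 in ll.
have := (d_ge0 x0 x1, d_ge0 x1 x2, d_ge0 y0 y1, d_ge0 y1 y2).
move=> [[[dx01 dx12] dy01] dy12].
have [x01|/eqP x01] := eqVneq x0 x1; last first.
  have := dist_gt0 HN x01 => {}dx01.
  rewrite /= cell_first_step //; last by left.
  rewrite (@fill_lt y1 y2); last by lra.
  by rewrite !sub0r opprD opprK.
have [y01|/eqP y01] := eqVneq y0 y1; last first.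
  have := dist_gt0 HN y01 => {}dy01.
  rewrite /= cell_first_step //; last by right.
  rewrite (@fill_lt y1 y2); last by lra.
  by rewrite !sub0r opprD opprK.
subst x1 y1; rewrite !d_self in ll.
rewrite (@fill_lt x0 x0) ?d_self // eqB.
have [y02|/eqP y02] := eqVneq y0 y2; last first.
  rewrite /= add0r; have [x02|/eqP x02] := eqVneq x0 x2.
    by subst x2; rewrite cell_translate //; rewrite d_self in ll; lra.
  rewrite cell_two_edges //; last by lra.
  rewrite (@fill_lt y0 y2) ?subr0 //; have := dist_gt0 HN x02; lra.
subst y2; rewrite d_self in ll; have {}ll : d x0 x2 = l by lra.
rewrite cell_edge // (@fill_lt y0 y0) ?d_self // subr0 addrC; congr (_ + _).
case: asboolP => //= g_dec; exact: edge_class_decomposable.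
Qed.

End CellsModuloBoundaries.
(** * The class of a 2-cell *)
Section IndecomposableClasses.

Variables (R : realType) (G : groupType) (N : G -> R) (l : R).
Hypotheses (HN : conj_inv_norm N) (l_gt0 : 0 < l).
Notation d := (norm_dist N).
Notation C2 := (diagonal_chain N l 2).

Definition class_gen (g : G) : {freeg (indec_class N l)} :=
  gen_value (fun g => insub (conj_class g)) g.

Lemma class_gen_eq0 g : ~ (indecomposable N g /\ N g = l) -> class_gen g = 0.
Proof.
move=> ng; rewrite /class_gen /gen_value insubN //.
by apply/asboolP => /(indec_classP HN).
Qed.

Lemma class_gen_conj h g : class_gen (h * g * h^-1)%g = class_gen g.
Proof. by rewrite /class_gen /gen_value conj_class_conj. Qed.

Lemma dist_self_neq a : d a a <> l.
Proof. by rewrite (dist_self HN) => l0; move: l_gt0; rewrite -l0 ltxx. Qed.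

Lemma class_gen_len a b : d a b <> l -> class_gen (b^-1 * a)%g = 0.
Proof. by move=> abl; apply: class_gen_eq0 => -[_ ]. Qed.

(** The Alexander-Whitney map to bidegree (1, 1) keeps the last edge of the first
    row, and the rest of the cell has to be constant for the length to be
    preserved. *)
Definition class_of_gen2 (s : {s : double_nerve N 2 2 | len s == l}) :
    option (indec_class N l) :=
  let x := val s ord0 in let y := val s ord_max in
  if [&& x ord0 == x (inord 1), y ord0 == y (inord 1) & y (inord 1) == y (inord 2)]
  then insub (conj_class ((x (inord 2))^-1 * x (inord 1))%g) else None.

Definition class_map : {additive C2 -> {freeg (indec_class N l)}} :=
  gen_map class_of_gen2.

Lemma class_map_gen2 x0 x1 x2 y0 y1 y2 :
  class_map (gen2 N l x0 x1 x2 y0 y1 y2) =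
  if [&& x0 == x1, y0 == y1 & y1 == y2] then class_gen (x2^-1 * x1)%g else 0.
Proof.
have [xyl|xyl] := pselect (len2 N x0 x1 x2 y0 y1 y2 = l); last first.
  rewrite gen2_len0 // raddf0; case: ifP => // /and3P[/eqP x01 /eqP y01 /eqP y12].
  rewrite class_gen_len // => x12; apply: xyl.
  by rewrite /len2 x01 y01 y12 !(dist_self HN) x12 add0r !addr0.
have sl : len (simplices N 2 2 [:: [:: x0; x1; x2]; [:: y0; y1; y2]]) == l.
  by rewrite len_simplices22 xyl.
rewrite /gen2 (gen_at_len sl) [LHS]gen_mapE /gen_value /class_of_gen2.
rewrite /= !ffunE /= !inordK //=.
by case: ifP.
Qed.

Lemma class_map_gen2_len x0 x1 x2 y0 y1 y2 : d x1 x2 <> l ->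
  class_map (gen2 N l x0 x1 x2 y0 y1 y2) = 0.
Proof.
by move=> x12; rewrite class_map_gen2; case: ifP => // _; exact: class_gen_len.
Qed.

Lemma class_gen_between a m b : m <> a -> m <> b -> d a m + d m b <= l ->
  class_gen (b^-1 * a)%g = 0.
Proof.
move=> ma mb amb; apply: class_gen_eq0 => -[ab_indec abl].
apply: (between_decomposable ma mb _ ab_indec); apply/eqP.
rewrite eq_le (dist_triangle HN) andbT.
by rewrite [leRHS]abl.
Qed.

(** A term can be nonzero only if its last edge has length l; then all the other
    steps of the 3-cell are constant, up to one that would decompose this edge.
    The terms that survive cancel in pairs, by left invariance of the distance or
    by invariance of classes under conjugation. *)
Lemma class_map_boundary3 x0 x1 x2 x3 y0 y1 y2 y3 z0 z1 z2 z3 :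
  len3 N x0 x1 x2 x3 y0 y1 y2 y3 z0 z1 z2 z3 = l ->
  class_map (gen2 N l y1 y2 y3 z1 z2 z3)
  - class_map (gen2 N l (x0 * y0)%g (x2 * y2)%g (x3 * y3)%g z0 z2 z3)
  + class_map (gen2 N l x0 x1 x3 (y0 * z0)%g (y1 * z1)%g (y3 * z3)%g)
  - class_map (gen2 N l x0 x1 x2 y0 y1 y2) = 0.
Proof.
rewrite /len3 => xyzl.
have lt_neq (a b : G) : d a b < l -> d a b <> l by move=> + ab; rewrite ab ltxx.
have := (dist_ge0 HN x0 x1, dist_ge0 HN x1 x2, dist_ge0 HN x2 x3).
move=> [[dx01 dx12] dx23].
have := (dist_ge0 HN y0 y1, dist_ge0 HN y1 y2, dist_ge0 HN y2 y3).
move=> [[dy01 dy12] dy23].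
have := (dist_ge0 HN z0 z1, dist_ge0 HN z1 z2, dist_ge0 HN z2 z3).
move=> [[dz01 dz12] dz23].
have tx := dist_triangle HN x1 x2 x3.
have mxy23 := dist_mul HN x2 x3 y2 y3.
have zero4 (A : zmodType) : 0 - 0 + 0 - 0 = 0 :> A by rewrite subrr addr0 subr0.
(* A moving last row takes length away from all four last edges. *)
have [|zc] := ltP 0 (d z0 z1 + d z1 z2 + d z2 z3).
  by move=> z_gt0; rewrite !class_map_gen2_len ?zero4 //; apply: lt_neq; lra.
have ez01 : z0 = z1 by apply: (dist_eq0 HN); lra.
have ez12 : z1 = z2 by apply: (dist_eq0 HN); lra.
have ez23 : z2 = z3 by apply: (dist_eq0 HN); lra.
move: xyzl; rewrite {}ez01 {}ez12 {}ez23 !(dist_self HN) !addr0 => xyl.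
clear z0 z1 z2 dz01 dz12 dz23 zc; move: z3 => z.
(* If the second row moves, the last two terms vanish and the first two cancel. *)
have [y_gt0|yc] := ltP 0 (d y0 y1 + d y1 y2 + d y2 y3).
  rewrite (@class_map_gen2_len _ x1 x3); last by apply: lt_neq; lra.
  rewrite (@class_map_gen2_len _ x1 x2); last by apply: lt_neq; lra.
  rewrite addr0 subr0; apply/eqP; rewrite subr_eq0; apply/eqP.
  have [y23|/eqP y23] := eqVneq y2 y3.
    rewrite !class_map_gen2_len // -y23; last exact: dist_self_neq.
    rewrite (dist_mulr HN); apply: lt_neq.
    move: xyl y_gt0; rewrite y23 (dist_self HN) => xyl y_gt0; clear y23; lra.
  have {}dy23 := dist_gt0 HN y23.
  have [x23|/eqP x23] := eqVneq x2 x3; last first.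
    have {}dx23 := dist_gt0 HN x23.
    rewrite class_map_gen2_len; last by apply: lt_neq; lra.
    rewrite class_map_gen2; case: ifP => // _.
    rewrite (@class_gen_between _ (x2 * y3)%g) //.
    - by move=> /mulgI/esym.
    - by move=> /mulIg.
    - by rewrite (dist_mull N) (dist_mulr HN); lra.
  move: xyl; rewrite -x23 (dist_self HN) => xyl.
  have [x02|] := ltP 0 (d x0 x1 + d x1 x2 + (d y0 y1 + d y1 y2)).
    rewrite !class_map_gen2_len //; last first.
      by rewrite ?(dist_mull N); apply: lt_neq; clear x23; lra.
    by rewrite ?(dist_mull N); apply: lt_neq; clear x23; lra.
  clear x23 => xc.
  have ex01 : x0 = x1 by apply: (dist_eq0 HN); lra.
  have ex12 : x1 = x2 by apply: (dist_eq0 HN); clear ex01; lra.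
  have ey01 : y0 = y1 by apply: (dist_eq0 HN); clear ex01 ex12; lra.
  have ey12 : y1 = y2 by apply: (dist_eq0 HN); clear ex01 ex12 ey01; lra.
  rewrite {}ex01 {}ex12 {}ey01 {}ey12 !class_map_gen2 !eqxx /=.
  by rewrite invgM -!mulgA mulKg.
(* Now only the first row moves: the first term vanishes. *)
have ey01 : y0 = y1 by apply: (dist_eq0 HN); lra.
have ey12 : y1 = y2 by apply: (dist_eq0 HN); clear ey01; lra.
have ey23 : y2 = y3 by apply: (dist_eq0 HN); clear ey01 ey12; lra.
move: xyl; rewrite {}ey01 {}ey12 {}ey23 !(dist_self HN) !addr0 => xl.
clear y0 y1 y2 dy01 dy12 dy23 mxy23 yc; move: y3 => y.
rewrite (@class_map_gen2_len _ y y); last exact: dist_self_neq.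
rewrite sub0r.
have [x01|/eqP x01] := eqVneq x0 x1; last first.
  have {}dx01 := dist_gt0 HN x01.
  by rewrite !class_map_gen2_len ?subrr ?oppr0 ?addr0 ?subr0 //
    ?(dist_mulr HN); apply: lt_neq; lra.
subst x1; rewrite (dist_self HN) add0r in xl.
rewrite !class_map_gen2 !eqxx /= andbT.
have -> : ((x3 * y)^-1 * (x2 * y) = y^-1 * (x3^-1 * x2) * y^-1^-1)%g.
  by rewrite invgM invgK !mulgA.
rewrite class_gen_conj.
have [x02|/eqP x02] := eqVneq x0 x2.
  subst x2; rewrite eqxx addNr sub0r class_gen_len ?oppr0 //.
  exact: dist_self_neq.
rewrite (inj_eq (@mulIg _ y)) (negPf (introN eqP x02)) oppr0 add0r.
have [x23|/eqP x23] := eqVneq x2 x3; first by rewrite x23 subrr.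
have {}dx23 := dist_gt0 HN x23.
rewrite (class_gen_len (a := x0) (b := x2)) ?subr0; last by apply: lt_neq; lra.
by apply: (@class_gen_between _ x2); [exact/nesym | exact | lra].
Qed.

End IndecomposableClasses.
(** * Positive length gradings *)
Section PositiveLength.

Variables (R : realType) (G : groupType) (N : G -> R) (l : R).
Hypotheses (HN : conj_inv_norm N) (l_gt0 : 0 < l).
Notation d := (norm_dist N).
Notation gen1 := (gen1 N l).
Notation gen2 := (gen2 N l).
Notation gen3 := (gen3 N l).
Notation bd := (fun n : nat =>
  [the {additive diagonal_chain N l n.+1 -> diagonal_chain N l n}
     of @alt_sum _ (diagonal_face N l) n]).

Lemma chain0_eq0 (x : diagonal_chain N l 0) : x = 0.
Proof.
apply: (@graded_piece_ext _ _ _ _ idfun \0) => s sl.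
by move: l_gt0; rewrite -sl /= big_ord0 ltxx.
Qed.

Lemma chain1_ext (A : zmodType) (f g : {additive diagonal_chain N l 1 -> A}) :
  (forall a b, d a b = l -> f (gen1 a b) = g (gen1 a b)) -> f =1 g.
Proof.
move=> fg; apply: graded_piece_ext => s sl.
have sE : s = simplices N 1 1 [:: [:: s ord0 ord0; s ord0 ord_max]].
  apply/ffunP => -[[|k] lt_k] //; apply/ffunP => -[[|[|j]] lt_j] //;
    rewrite !ffunE /=; by congr (s _ _); apply: val_inj.
by rewrite sE; apply: fg; rewrite -sl [in RHS]sE len_simplices11.
Qed.

Lemma chain2_ext (A : zmodType) (f g : {additive diagonal_chain N l 2 -> A}) :
  (forall x0 x1 x2 y0 y1 y2, len2 N x0 x1 x2 y0 y1 y2 = l ->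
    f (gen2 x0 x1 x2 y0 y1 y2) = g (gen2 x0 x1 x2 y0 y1 y2)) -> f =1 g.
Proof.
move=> fg; apply: graded_piece_ext => s sl.
have sE : s = simplices N 2 2
    [:: [:: s ord0 ord0; s ord0 (inord 1); s ord0 ord_max];
        [:: s ord_max ord0; s ord_max (inord 1); s ord_max ord_max]].
  apply/ffunP => -[[|[|k]] lt_k] //; apply/ffunP => -[[|[|[|j]]] lt_j] //;
    rewrite !ffunE /=; by congr (s _ _); apply: val_inj; rewrite //= inordK.
by rewrite sE; apply: fg; rewrite -sl [in RHS]sE len_simplices22.
Qed.

Lemma chain3_ext (A : zmodType) (f g : {additive diagonal_chain N l 3 -> A}) :
  (forall x0 x1 x2 x3 y0 y1 y2 y3 z0 z1 z2 z3,
    len3 N x0 x1 x2 x3 y0 y1 y2 y3 z0 z1 z2 z3 = l ->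
    f (gen3 x0 x1 x2 x3 y0 y1 y2 y3 z0 z1 z2 z3) =
    g (gen3 x0 x1 x2 x3 y0 y1 y2 y3 z0 z1 z2 z3)) -> f =1 g.
Proof.
move=> fg; apply: graded_piece_ext => s sl.
pose i1 : 'I_3 := inord 1; pose j1 : 'I_4 := inord 1; pose j2 : 'I_4 := inord 2.
have sE : s = simplices N 3 3
    [:: [:: s ord0 ord0; s ord0 j1; s ord0 j2; s ord0 ord_max];
        [:: s i1 ord0; s i1 j1; s i1 j2; s i1 ord_max];
        [:: s ord_max ord0; s ord_max j1; s ord_max j2; s ord_max ord_max]].
  apply/ffunP => -[[|[|[|k]]] lt_k] //; apply/ffunP => -[[|[|[|[|j]]]] lt_j] //;
    rewrite !ffunE /=; by congr (s _ _); apply: val_inj; rewrite //= inordK.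
by rewrite sE; apply: fg; rewrite -sl [in RHS]sE len_simplices33.
Qed.

Definition fill_gen (s : double_nerve N 1 1) : double_nerve N 2 2 :=
  let a := s ord0 ord0 in let b := s ord0 ord_max in
  simplices N 2 2 [:: [:: 1%g; 1%g; 1%g]; [:: a; b; b]].

Definition fill_map : {additive diagonal_chain N l 1 -> diagonal_chain N l 2} :=
  Sigma_map fill_gen l.

Lemma fill_map_gen1 a b : fill_map (gen1 a b) = gen2 1%g 1%g 1%g a b b.
Proof.
have [abl|abl] := pselect (d a b = l).
  by rewrite /fill_map Sigma_map_gen ?len_simplices11 // /fill_gen !ffunE.
rewrite gen1_len0 // raddf0 gen2_len0 //.
by rewrite /len2 !(dist_self HN) !add0r addr0.
Qed.

Lemma bd_fill_map x : bd 1%N (fill_map x) = - x.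
Proof.
move: x.
apply: (@chain1_ext _ [the {additive _ -> _} of bd 1%N \o fill_map] -%R) => a b abl.
rewrite [LHS]/= fill_map_gen1 boundary2 //; last first.
  by rewrite /len2 !(dist_self HN) !add0r addr0.
rewrite !mul1g (gen1_len0 (a := b)); last exact: dist_self_neq.
by rewrite (gen1_len0 (a := 1%g)) ?sub0r ?addr0 //; exact: dist_self_neq.
Qed.

Lemma class_map_bd x : class_map N l (bd 2%N x) = 0.
Proof.
move: x; apply: (@chain3_ext _
  [the {additive _ -> _} of class_map N l \o bd 2%N] \0) => *.
by rewrite [LHS]/= boundary3 // !(raddfB, raddfD) class_map_boundary3.
Qed.

Definition class_rep (C : indec_class N l) : G := sval (cid (asboolW (valP C))).

Lemma class_repP C : [/\ indecomposable N (class_rep C), N (class_rep C) = l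
  & val C = conj_class (class_rep C)].
Proof. by rewrite /class_rep; case: cid. Qed.

(** The shuffle of the bar generator g with the edge (g, 1): the signed sum of its
    two interleavings of degeneracies. *)
Definition shuffle_gen (C : indec_class N l) : diagonal_chain N l 2 :=
  let g := class_rep C in gen2 g g 1 1 1 1 - gen2 1 1 1 g 1 1.

Definition shuffle_map :
    {additive {freeg (indec_class N l)} -> diagonal_chain N l 2} :=
  additive_of (lift_is_additive
    (shuffle_gen : _ -> {freeg {s : double_nerve N 2 2 | len s == l}})).

Lemma shuffle_mapE C : shuffle_map << C >> = shuffle_gen C.
Proof. exact: fglift_gen. Qed.

Lemma bd_shuffle a : bd 1%N (shuffle_map a) = 0.
Proof.
move: a; apply: (@freeg_additive_ext _ _
  [the {additive _ -> _} of bd 1%N \o shuffle_map] \0) => C.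
have [_ gl _] := class_repP C.
rewrite -[LHS]/(bd 1%N (shuffle_map << C >>)) shuffle_mapE /shuffle_gen.
set g := class_rep C in gl *.
have dg : d g 1%g = l by rewrite /norm_dist invg1 mul1g.
rewrite raddfB /= !boundary2 /len2 ?(dist_self HN) ?add0r ?addr0 // !mulg1 !mul1g.
by rewrite !(gen1_len0 (dist_self_neq HN l_gt0 (a := _))) !sub0r !addr0 subrr.
Qed.

Lemma class_map_shuffle a : class_map N l (shuffle_map a) = a.
Proof.
move: a; apply: (@freeg_additive_ext _ _
  [the {additive _ -> _} of class_map N l \o shuffle_map] idfun) => C.
have [g_indec gl Cg] := class_repP C.
rewrite -[LHS]/(class_map N l (shuffle_map << C >>)) shuffle_mapE /shuffle_gen.
set g := class_rep C in g_indec gl Cg *.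
rewrite raddfB !(class_map_gen2 l HN) !eqxx /=.
rewrite (negPf (introN eqP (proj1 g_indec))) subr0.
rewrite invg1 mul1g /class_gen /gen_value.
case: insubP => [C' _ CC'|]; first by congr << _ >>; apply: val_inj; rewrite CC' Cg.
by rewrite -Cg (valP C).
Qed.

(** The complex cut off below degree 2: its homology in degree 0 is the quotient of
    all 2-chains by the boundaries. *)
Definition bd_above (n : nat) :
  {additive diagonal_chain N l n.+3 -> diagonal_chain N l n.+2} := bd n.+2.

Definition mod_bd (x : diagonal_chain N l 2) : homology bd_above 0 :=
  \pi_(homology bd_above 0)%qT (Cycle (isT : cycle_pred bd_above (n := 0) x)).

Lemma mod_bdB : zmod_morphism mod_bd.
Proof. by move=> x y; rewrite /mod_bd -raddfB; apply: congr1; apply: val_inj. Qed.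

HB.instance Definition _ := GRing.isZmodMorphism.Build _ _ mod_bd mod_bdB.

Lemma mod_bd_eq x y : mod_bd x = mod_bd y <-> exists w, bd 2%N w = x - y.
Proof. exact: homology_pi_eq. Qed.

(** [cell_homotopy] in the quotient by boundaries; [shuffle_map] uses some chosen
    element of the class of x2^-1 x1, which is harmless by [edge_class_conj]. *)
Lemma mod_bd_homotopy x :
  mod_bd x = mod_bd (shuffle_map (class_map N l x)) - mod_bd (fill_map (bd 1%N x)).
Proof.
pose cell x0 x1 x2 y0 y1 y2 := mod_bd (gen2 x0 x1 x2 y0 y1 y2).
have cell_len x0 x1 x2 y0 y1 y2 :
    len2 N x0 x1 x2 y0 y1 y2 <> l -> cell x0 x1 x2 y0 y1 y2 = 0.
  by move=> xyl; rewrite /cell gen2_len0 ?raddf0.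
have cell_bd x0 x1 x2 x3 y0 y1 y2 y3 z0 z1 z2 z3 :
    len3 N x0 x1 x2 x3 y0 y1 y2 y3 z0 z1 z2 z3 = l ->
    cell y1 y2 y3 z1 z2 z3
    - cell (x0 * y0)%g (x2 * y2)%g (x3 * y3)%g z0 z2 z3
    + cell x0 x1 x3 (y0 * z0)%g (y1 * z1)%g (y3 * z3)%g
    - cell x0 x1 x2 y0 y1 y2 = 0.
  move=> xyzl; rewrite /cell -!(raddfB, raddfD) -boundary3 //= -(raddf0 mod_bd).
  by apply/mod_bd_eq; eexists; rewrite subr0.
move: x; apply: (@chain2_ext _ mod_bd
  [the {additive _ -> _} of
     (mod_bd \o shuffle_map \o class_map N l) \- (mod_bd \o fill_map \o bd 1%N)]).
move=> x0 x1 x2 y0 y1 y2 xyl.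
have fill_bd : fill_map (bd 1%N (gen2 x0 x1 x2 y0 y1 y2)) =
    gen2 1 1 1 y1 y2 y2 - gen2 1 1 1 (x0 * y0)%g (x2 * y2)%g (x2 * y2)%g
    + gen2 1 1 1 x0 x1 x1.
  by rewrite /= boundary2 // raddfD raddfB !fill_map_gen1.
rewrite -[RHS]/(mod_bd (shuffle_map (class_map N l _))
                  - mod_bd (fill_map (bd 1%N _))).
rewrite fill_bd [in RHS](raddfD mod_bd) (raddfB mod_bd (gen2 _ _ _ _ _ _)).
rewrite -[LHS]/(cell x0 x1 x2 y0 y1 y2).
rewrite (cell_homotopy HN l_gt0 cell_len cell_bd xyl) /fill.
have s0 : mod_bd (shuffle_map 0) = 0 by rewrite (raddf0 shuffle_map) raddf0.
congr (_ - _); rewrite (class_map_gen2 l HN).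
case: eqP => [x01|_]; last by rewrite s0.
case: eqP => [y01|_]; last by rewrite s0.
case: eqP => [y12|_]; last by rewrite s0.
have gl : N (x2^-1 * x1)%g = l.
  by rewrite -xyl /len2 x01 y01 y12 !(dist_self HN) add0r !addr0.
case: asboolP => [g_indec|g_dec]; last first.
  by rewrite (class_gen_eq0 HN) ?s0 // => -[].
rewrite /class_gen /gen_value; case: insubP => [C _ CE|/asboolP[]]; last first.
  by apply/(indec_classP HN).
have [_ hl] := class_repP C; rewrite CE => /conj_class_eq[h hE].
rewrite shuffle_mapE /shuffle_gen raddfB -/(edge_class cell (class_rep C)).
by rewrite hE (edge_class_conj HN l_gt0 cell_len cell_bd).
Qed.

Lemma iterated_MH0_eq0 (x : iterated_MH N l 0) : x = 0.
Proof.
by move: x; apply: homology_eq0 => x; exists 0; rewrite raddf0 [RHS]chain0_eq0.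
Qed.

Lemma iterated_MH1_eq0 (x : iterated_MH N l 1) : x = 0.
Proof.
move: x; apply: homology_eq0 => x.
by exists (- fill_map (val x)); rewrite raddfN bd_fill_map opprK.
Qed.

(** On a cycle x without classes, [mod_bd_homotopy] says that x is zero modulo
    boundaries. *)
Lemma iterated_MH2_iso : ab_iso (iterated_MH N l 2) {freeg (indec_class N l)}.
Proof.
pose phi (z : cycle bd 2) := class_map N l (val z).
have phiB : zmod_morphism phi by move=> x y; rewrite /phi !raddfB.
apply: (@homology_iso _ bd 2 _ (additive_of phiB)) => [a|z].
  have za : cycle_pred bd (n := 2) (shuffle_map a) by apply/eqP/bd_shuffle.
  by exists (Cycle za); exact: class_map_shuffle.
split=> [phiz|[w dw]]; last by rewrite /= /phi -dw class_map_bd.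
have /eqP dz : bd 1%N (val z) == 0 := valP z.
have := mod_bd_homotopy (val z).
rewrite dz [class_map _ _ _]phiz (raddf0 shuffle_map) (raddf0 fill_map) subrr.
rewrite -(raddf0 mod_bd) => /mod_bd_eq[w dw].
by exists w; rewrite dw subr0.
Qed.

End PositiveLength.

Theorem theorem7p11 (R : realType) (G : groupType) (N : G -> R)
    (HN : conj_inv_norm N) :
  (forall k : nat, ab_iso (iterated_MH N 0 k) (group_homology G k)) /\
  (forall l : R, 0 < l ->
     [/\ (forall x : iterated_MH N l 0, x = 0),
         (forall x : iterated_MH N l 1, x = 0)
       & ab_iso (iterated_MH N l 2) {freeg (indec_class N l)}]).
Proof.
split=> [k|l l_gt0]; first exact: iterated_MH_length0.
split; [exact: iterated_MH0_eq0 | exact: iterated_MH1_eq0 | exact: iterated_MH2_iso].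
Qed.
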